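(* Let $G$ be a finite group and $p$ a prime. Given synthetic buildings $\Delta_1,\Delta_2$ for $G$ at $p$, the operation $(\Delta_1,\Delta_2)\mapsto \mathrm{SB}(\Delta_1*\Delta_2)$, where $G$ acts diagonally on the join $\Delta_1*\Delta_2$, induces a well-defined associative binary operation on the set of $G$-equivariant homotopy equivalence classes of synthetic buildings for $G$ at $p$. Thus the set of $G$-equivariant homotopy equivalence classes of synthetic buildings becomes a semigroup under this operation.
   Context: A $G$-simplicial complex is a finite (possibly empty) simplicial complex $\Delta$ with a simplicial action of the finite group $G$ such that the setwise stabilizer of each simplex fixes that simplex pointwise. For $H\le G$, $\Delta^H$ denotes the fixed point subcomplex. Contractible spaces are non-empty. A $G$-simplicial complex $\Delta$ is a weak synthetic building for $G$ at the prime $p$ if (1) $\Delta^P$ is $N_G(P)$-equivariantly contractible for every non-identity $p$-subgroup $P\le G$; it is a synthetic building if in addition (2) the stabilizer of every simplex has order divisible by $p$. For a weak synthetic building $\Delta$, $\mathrm{SB}(\Delta)$ is the subcomplex consisting of the simplices of $\Delta$ whose stabilizers in $G$ have order divisible by $p$; it is a synthetic building. The join $\Delta_1*\Delta_2$ has as vertices the disjoint union of the vertices of $\Delta_1$ and of $\Delta_2$, and as simplices the sets $a$, $b$ and $a\cup b$ with $a\in\Delta_1$, $b\in\Delta_2$; the diagonal action is $g(a\cup b)=ga\cup gb$. (If $p\nmid|G|$ the only synthetic building is the empty complex, and the join of empty complexes is empty.) With the diagonal action the join of weak synthetic buildings for $G$ is a weak synthetic building for $G$. *)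

(* Defs.v *)
From HB Require Import structures.
From mathcomp Require Import all_boot all_fingroup all_solvable.

Set Implicit Arguments.
Unset Strict Implicit.
Unset Printing Implicit Defensive.

Import GroupScope.

(* Finite G-simplicial complexes.  [vert] is an ambient finite G-set: the      *)
(* vertices of the complex are the v with [set v] \in simplices, so that a     *)
(* subcomplex keeps the same [vert].  Simplices are non-empty, and the complex *)
(* may be empty.  Actions are right actions, as everywhere in MathComp; the    *)
(* left action g v of the literature is [gact v g^-1].                         *)
Record gcomplex (gT : finGroupType) (G : {group gT}) := GComplex {
  vert : finType;
  gact : action G vert;
  simplices : {set {set vert}};
  simplices_neq0 : set0 \notin simplices;
  simplices_face : forall s t : {set vert},
    s \in simplices -> t \subset s -> t != set0 -> t \in simplices;
  simplices_act : forall (g : gT) (s : {set vert}),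
    g \in G -> s \in simplices -> [set gact v g | v in s] \in simplices;
  simplices_stab : forall s : {set vert},
    s \in simplices -> 'N_G(s | gact) \subset 'C_G(s | gact)
}.

Definition stabilizer (gT : finGroupType) (G : {group gT})
    (D : gcomplex G) (s : {set vert D}) : {set gT} := 'N_G(s | gact D).
Arguments stabilizer {gT G} D s.

Definition fixed_simplices (gT : finGroupType) (G : {group gT})
    (D : gcomplex G) (H : {set gT}) : {set {set vert D}} :=
  [set s in simplices D | s \subset 'Fix_(gact D)(H)].

Section SB.
Variables (gT : finGroupType) (G : {group gT}) (p : nat) (D : gcomplex G).

Definition SB_simplices : {set {set vert D}} :=
  [set s in simplices D | p %| #|stabilizer D s|].

Lemma SB_neq0 : set0 \notin SB_simplices.
Proof. by rewrite inE negb_and simplices_neq0. Qed.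

Lemma SB_face (s t : {set vert D}) :
  s \in SB_simplices -> t \subset s -> t != set0 -> t \in SB_simplices.
Proof.
rewrite !inE => /andP[sD ps] ts t0; rewrite (simplices_face sD) //=.
apply: dvdn_trans ps _; apply: cardSg; apply/subsetP => g gs.
have := subsetP (simplices_stab sD) g gs.
rewrite !inE => /andP[gG /andP[_ /subsetP fs]]; rewrite gG /=.
apply/subsetP => v vt; rewrite inE.
by have := fs v (subsetP ts v vt); rewrite inE => /eqP ->.
Qed.

Lemma SB_stabJ (g : gT) (s : {set vert D}) : g \in G ->
  #|stabilizer D [set gact D v g | v in s]| = #|stabilizer D s|.
Proof.
move=> gG; rewrite /stabilizer -!astab1_set.
have -> : [set gact D v g | v in s] = ((gact D)^*)%act s g by [].
by rewrite astab1_act_in // -{1}(conjGid gG) -conjIg cardJg.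
Qed.

Lemma SB_act_closed (g : gT) (s : {set vert D}) : g \in G -> s \in SB_simplices ->
  [set gact D v g | v in s] \in SB_simplices.
Proof.
move=> gG; rewrite !inE => /andP[sD ps].
by rewrite simplices_act // SB_stabJ.
Qed.

Lemma SB_stab (s : {set vert D}) :
  s \in SB_simplices -> 'N_G(s | gact D) \subset 'C_G(s | gact D).
Proof. by rewrite inE => /andP[sD _]; apply: simplices_stab. Qed.

Definition SB : gcomplex G := GComplex SB_neq0 SB_face SB_act_closed SB_stab.

End SB.

Section Join.
Variables (gT : finGroupType) (G : {group gT}) (D1 D2 : gcomplex G).

Definition join_act (v : vert D1 + vert D2) (g : gT) : vert D1 + vert D2 :=
  match v with
  | inl v1 => inl (gact D1 v1 g)
  | inr v2 => inr (gact D2 v2 g)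
  end.

Lemma join_is_action : is_action G join_act.
Proof.
split=> [g [u|u] [v|v] //= []|[v|v] g h gG hG /=].
- by move=> /act_inj ->.
- by move=> /act_inj ->.
- by rewrite actMin.
- by rewrite actMin.
Qed.

Definition join_action : action G (vert D1 + vert D2)%type :=
  Action join_is_action.

Definition join_simplices : {set {set (vert D1 + vert D2)%type}} :=
  [set inl @: a | a : {set vert D1} in simplices D1]
    :|: [set inr @: b | b : {set vert D2} in simplices D2]
    :|: [set inl @: a :|: inr @: b | a : {set vert D1} in simplices D1,
                                     b : {set vert D2} in simplices D2].

Definition join_lpart (s : {set (vert D1 + vert D2)%type}) : {set vert D1} :=
  [set v | inl v \in s].
Definition join_rpart (s : {set (vert D1 + vert D2)%type}) : {set vert D2} :=
  [set v | inr v \in s].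

Lemma join_memE (a : {set vert D1}) (b : {set vert D2}) v :
  (v \in inl @: a :|: inr @: b) =
  match v with inl v1 => v1 \in a | inr v2 => v2 \in b end.
Proof.
case: v => v; rewrite inE.
  rewrite (mem_imset _ _ (@inl_inj _ _)) [X in _ || X](_ : _ = false) ?orbF //.
  by apply/imsetP => -[].
rewrite (mem_imset _ _ (@inr_inj _ _)) [X in X || _](_ : _ = false) //.
by apply/imsetP => -[].
Qed.

Lemma join_partE s : s = inl @: join_lpart s :|: inr @: join_rpart s.
Proof. by apply/setP => -[v|v]; rewrite join_memE inE. Qed.

Lemma join_lpartU (a : {set vert D1}) (b : {set vert D2}) :
  join_lpart (inl @: a :|: inr @: b) = a.
Proof. by apply/setP => v; rewrite inE join_memE. Qed.

Lemma join_rpartU (a : {set vert D1}) (b : {set vert D2}) :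
  join_rpart (inl @: a :|: inr @: b) = b.
Proof. by apply/setP => v; rewrite inE join_memE. Qed.

Lemma join_simplicesP s : reflect
  [/\ s != set0, join_lpart s \in set0 |: simplices D1
               & join_rpart s \in set0 |: simplices D2]
  (s \in join_simplices).
Proof.
apply: (iffP idP).
  move=> sJ; have [a [b [-> aD bD ab]]] : exists (a : {set vert D1}) (b : {set vert D2}),
      [/\ s = inl @: a :|: inr @: b, a \in set0 |: simplices D1,
          b \in set0 |: simplices D2 & (a != set0) || (b != set0)].
    have n1 (a : {set vert D1}) : a \in simplices D1 -> a != set0.
      by apply: contraTneq => ->; apply: simplices_neq0.
    have n2 (b : {set vert D2}) : b \in simplices D2 -> b != set0.
      by apply: contraTneq => ->; apply: simplices_neq0.
    move: sJ; rewrite !inE => /orP[/orP[]|].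
    + move=> /imsetP[a aD ->]; exists a, set0.
      by rewrite imset0 setU0 !inE aD eqxx orbT (n1 _ aD).
    + move=> /imsetP[b bD ->]; exists set0, b.
      by rewrite imset0 set0U !inE bD eqxx orbT (n2 _ bD).
    + move=> /imset2P[a b aD bD ->]; exists a, b.
      by rewrite !inE aD bD !orbT (n1 _ aD).
  rewrite join_lpartU join_rpartU; split=> //.
  apply: contraL ab; rewrite setU_eq0 !imset_eq0 => /andP[/eqP-> /eqP->].
  by rewrite !eqxx.
case; rewrite !inE => s0 /orP[/eqP l0|lD] /orP[/eqP r0|rD].
- by move: s0; rewrite (join_partE s) l0 r0 !imset0 setU0 eqxx.
- by rewrite (join_partE s) l0 imset0 set0U (imset_f _ rD) orbT.
- by rewrite (join_partE s) r0 imset0 setU0 (imset_f _ lD).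
- by rewrite (join_partE s) (imset2_f _ lD rD) orbT.
Qed.

Lemma join_neq0 : set0 \notin join_simplices.
Proof. by apply/join_simplicesP => -[]; rewrite eqxx. Qed.

Lemma join_face (s t : {set (vert D1 + vert D2)%type}) :
  s \in join_simplices -> t \subset s -> t != set0 -> t \in join_simplices.
Proof.
move=> /join_simplicesP[_ ls rs] /subsetP ts t0; apply/join_simplicesP; split=> //.
  have lts : join_lpart t \subset join_lpart s.
    by apply/subsetP => v; rewrite !inE => /ts.
  move: ls; rewrite !inE; have [//|l0 /=] := eqVneq (join_lpart t) set0.
  case/orP => [/eqP ls|ls]; last exact: simplices_face lts l0.
  by move: lts l0; rewrite ls subset0 => /eqP ->; rewrite eqxx.
have rts : join_rpart t \subset join_rpart s.
  by apply/subsetP => v; rewrite !inE => /ts.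
move: rs; rewrite !inE; have [//|r0 /=] := eqVneq (join_rpart t) set0.
case/orP => [/eqP rs|rs]; last exact: simplices_face rts r0.
by move: rts r0; rewrite rs subset0 => /eqP ->; rewrite eqxx.
Qed.

Lemma join_act_closed (g : gT) (s : {set (vert D1 + vert D2)%type}) :
  g \in G -> s \in join_simplices ->
  [set join_action v g | v in s] \in join_simplices.
Proof.
move=> gG /join_simplicesP[s0 ls rs].
have E : [set join_action v g | v in s] =
    inl @: [set gact D1 v g | v in join_lpart s]
    :|: inr @: [set gact D2 v g | v in join_rpart s].
  rewrite {1}(join_partE s) imsetU -!imset_comp.
  by congr (_ :|: _); apply: eq_imset.
apply/join_simplicesP; split; first by rewrite imset_eq0.
  rewrite E join_lpartU; move: ls; rewrite !inE.
  case/orP => [/eqP ->|ls]; first by rewrite imset0 eqxx.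
  by rewrite (simplices_act gG ls) orbT.
rewrite E join_rpartU; move: rs; rewrite !inE.
case/orP => [/eqP ->|rs]; first by rewrite imset0 eqxx.
by rewrite (simplices_act gG rs) orbT.
Qed.

Lemma join_stab (s : {set (vert D1 + vert D2)%type}) :
  s \in join_simplices -> 'N_G(s | join_action) \subset 'C_G(s | join_action).
Proof.
move=> /join_simplicesP[_ ls rs]; apply/subsetP => g.
rewrite !inE => /andP[gG /andP[_ /subsetP gs]]; rewrite gG /=.
apply/subsetP => -[v|v] vs; rewrite inE /=; apply/eqP.
  move: ls; rewrite !inE => /orP[/eqP ls|ls].
    by have : v \in join_lpart s; [rewrite inE|rewrite ls inE].
  have : g \in 'N_G(join_lpart s | gact D1).
    rewrite !inE gG /=; apply/subsetP => u; rewrite !inE => /gs.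
    by rewrite inE.
  move/(subsetP (simplices_stab ls)); rewrite !inE => /andP[_ /andP[_]].
  by move=> /subsetP /(_ v); rewrite !inE => /(_ vs) /eqP ->.
move: rs; rewrite !inE => /orP[/eqP rs|rs].
  by have : v \in join_rpart s; [rewrite inE|rewrite rs inE].
have : g \in 'N_G(join_rpart s | gact D2).
  rewrite !inE gG /=; apply/subsetP => u; rewrite !inE => /gs.
  by rewrite inE.
move/(subsetP (simplices_stab rs)); rewrite !inE => /andP[_ /andP[_]].
by move=> /subsetP /(_ v); rewrite !inE => /(_ vs) /eqP ->.
Qed.

Definition join : gcomplex G := GComplex join_neq0 join_face join_act_closed join_stab.

End Join.

From mathcomp Require Import all_order all_algebra.
From mathcomp Require Import all_classical all_reals all_analysis.

Import GRing.Theory Num.Theory.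
Import numFieldNormedType.Exports.
Local Open Scope classical_set_scope.
Local Open Scope ring_scope.

(* Spaces are subsets X of an ambient T, and aT : T -> gT -> T is only         *)
(* required to behave as a right action of K on X.                             *)
Section EquivariantHomotopy.
Variables (R : realType) (gT : finGroupType) (K : {set gT}).

Definition equivariant_map (T U : topologicalType)
    (aT : T -> gT -> T) (X : set T) (aU : U -> gT -> U) (Y : set U)
    (f : T -> U) : Prop :=
  [/\ {within X, continuous f},
      forall x, X x -> Y (f x)
    & forall x k, X x -> k \in K -> f (aT x k) = aU (f x) k].

Definition equivariantly_homotopic (T U : topologicalType)
    (aT : T -> gT -> T) (X : set T) (aU : U -> gT -> U) (Y : set U)
    (f g : T -> U) : Prop :=
  exists H : T * R -> U,
    [/\ {within X `*` `[0, 1], continuous H},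
        forall x (s : R), X x -> `[0, 1]%classic s -> Y (H (x, s)),
        forall x (s : R) k, X x -> `[0, 1]%classic s -> k \in K ->
          H (aT x k, s) = aU (H (x, s)) k,
        forall x, X x -> H (x, 0) = f x
      & forall x, X x -> H (x, 1) = g x].

Definition equivariantly_homotopy_equivalent (T U : topologicalType)
    (aT : T -> gT -> T) (X : set T) (aU : U -> gT -> U) (Y : set U) : Prop :=
  exists (f : T -> U) (g : U -> T),
    [/\ equivariant_map aT X aU Y f,
        equivariant_map aU Y aT X g,
        equivariantly_homotopic aT X aT X (g \o f) id
      & equivariantly_homotopic aU Y aU Y (f \o g) id].

Definition equivariantly_contractible (T : topologicalType)
    (aT : T -> gT -> T) (X : set T) : Prop :=
  exists x0 : T,
    [/\ X x0, forall k, k \in K -> aT x0 k = x0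
      & equivariantly_homotopic aT X aT X id (cst x0)].

End EquivariantHomotopy.

(* Geometric realization in barycentric coordinates, as a subspace of R^V.     *)
Definition realization (R : realType) (V : finType) (S : {set {set V}}) :
    set {ptws V -> R} :=
  [set t | [/\ forall v, 0 <= t v, \sum_v t v = 1
             & [set v | t v != 0]%SET \in S]].

Arguments realization R {V} S _.

(* Maps the Dirac function at v to the Dirac function at to v g.               *)
Definition realization_act (R : realType) (gT : finGroupType) (G : {set gT})
    (V : finType) (to : action G V) (t : {ptws V -> R}) (g : gT) :
    {ptws V -> R} :=
  fun v => t (to v (g^-1)%g).

Section SyntheticBuildings.
Variables (R : realType) (gT : finGroupType) (G : {group gT}) (p : nat).

Definition G_homotopy_equivalent (D E : gcomplex G) : Prop :=
  equivariantly_homotopy_equivalent R G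
    (@realization_act R _ _ _ (gact D)) (realization R (simplices D))
    (@realization_act R _ _ _ (gact E)) (realization R (simplices E)).

Definition weak_synthetic_building (D : gcomplex G) : Prop :=
  forall P : {group gT}, P \subset G -> p.-group P -> P :!=: 1%g ->
    equivariantly_contractible R (G :&: 'N(P))%g
      (@realization_act R _ _ _ (gact D))
      (realization R (fixed_simplices D P)).

Definition synthetic_building (D : gcomplex G) : Prop :=
  weak_synthetic_building D /\
  forall s : {set vert D}, s \in simplices D -> (p %| #|stabilizer D s|)%N.

Definition synthetic_class (D : gcomplex G) : gcomplex G -> Prop :=
  fun E => synthetic_building E /\ G_homotopy_equivalent D E.

(* Plain predicates, since [set (gcomplex G)] is a universe inconsistency.     *)
Definition synthetic_classes : Type :=
  {C : gcomplex G -> Prop |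
    exists2 D, synthetic_building D & C = synthetic_class D}.

End SyntheticBuildings.

(* Main.v *)
(* A point x of |D| lies in |SB p D| iff p divides the order of its stabilizer, *)
(* which is the stabilizer of the carrier of x, and equivariant maps only       *)
(* enlarge stabilizers; hence SB preserves equivariant homotopy equivalences.   *)
(* The join preserves them in its left factor: a point of the join is           *)
(* (r a, (1 - r) b), and f acts by (r f(a), (1 - r) b), which stays continuous  *)
(* at r = 0 because f(a) is bounded.  Commutativity and associativity of the    *)
(* join up to equivariant isomorphism, together with                            *)
(* SB(SB(D1 * D2) * D3) = SB(D1 * D2 * D3), give the rest.  The fixed points of *)
(* SB(D1 * D2) under a nontrivial p-subgroup are the join of those of D1 and    *)
(* D2, which contracts first to a cone and then to its apex.                    *)
Require Import Defs.
From mathcomp Require Import all_boot all_fingroup all_solvable.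
From mathcomp Require Import all_order all_algebra.
From mathcomp Require Import all_classical all_reals all_analysis.

Import Defs.

Set Implicit Arguments.
Unset Strict Implicit.
Unset Printing Implicit Defensive.

Import Order.TTheory GRing.Theory Num.Theory.
Import numFieldNormedType.Exports.
Local Open Scope classical_set_scope.
Local Open Scope ring_scope.

(** * Continuity on subsets and equivariant homotopies *)

(** A point of a realization lies in the realization of [SB] exactly when p divides the order of its
    stabilizer in G ([stabilizer_support]). Equivariant maps and homotopies can only enlarge
    stabilizers, so they restrict to [SB], and [SB] respects equivalence
    ([G_homotopy_equivalent_SB]). A point of a join is a convex combination of a point of each
    factor ([realization_join]), so a map or homotopy of the left factor extends by the identity on
    the right ([joinmap]). The delicate place is where the left mass vanishes, and
    [continuous_on_bounded_mul] settles it. Hence the join respects equivalence in the left factor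
    and, by commutativity, in both ([G_homotopy_equivalent_join]), so the product of classes is well
    defined.

    The product is again a synthetic building because the fixed points of [SB] of a join under a
    nontrivial p-subgroup form the whole join of the fixed points ([fixed_simplices_SB_join]), which
    contracts once its left factor does ([equivariantly_contractible_joinl]). Associativity reduces
    to that of the join, since trimming a factor by [SB] beforehand does not change the final [SB]
    ([SB_joinl], [SB_joinr]). *)

Definition continuous_on (T U : topologicalType) (X : set T) (f : T -> U) :=
  forall x, X x -> f @ within X (nbhs x) --> f x.

Section ContinuityOn.
Variables (R : realType) (T : topologicalType).
Implicit Types (X : set T).

(** Replaces the subspace topology by limits along a filter, to which the limit rules for sums,
    products and inverses apply. *)
Lemma continuous_onP (U : topologicalType) X (f : T -> U) :
  {within X, continuous f} <-> continuous_on X f.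
Proof. exact: subspace_continuousP. Qed.

Lemma continuous_on_comp (U W : topologicalType) X (Y : set U)
    (f : T -> U) (g : U -> W) :
  continuous_on X f -> (forall x, X x -> Y (f x)) ->
  continuous_on Y g ->
  continuous_on X (g \o f).
Proof.
move=> cf fXY cg x Xx S /= /(cg _ (fXY _ Xx)) gS.
have := cf x Xx _ gS; rewrite /= !nbhs_simpl /within /=.
by apply: filterS => y + Xy; apply => //; exact: fXY.
Qed.

Lemma continuous_onW (U : topologicalType) X Y (f : T -> U) :
  Y `<=` X -> continuous_on X f -> continuous_on Y f.
Proof.
move=> YX cf x Yx S /(cf _ (YX _ Yx)); rewrite /= !nbhs_simpl /within /=.
by apply: filterS => y + Yy; apply; exact: YX.
Qed.

Lemma continuousW (U : topologicalType) X (f : T -> U) :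
  continuous f -> continuous_on X f.
Proof. by move=> cf x _; apply: cvg_within_filter; exact: cf. Qed.

Lemma continuous_on_pair (U W : topologicalType) X (f : T -> U) (g : T -> W) :
  continuous_on X f -> continuous_on X g ->
  continuous_on X (fun x => (f x, g x)).
Proof. by move=> cf cg x Xx; apply: cvg_pair; [exact: cf|exact: cg]. Qed.

Lemma continuous_on_ptws (V : finType) X (f : T -> {ptws V -> R}) :
  continuous_on X f <-> forall v, continuous_on X (fun x => f x v).
Proof.
split=> [cf v x Xx|cf x Xx].
  by move=> S Sv; exact: cf x Xx _ (@proj_continuous V (fun=> R) v (f x) S Sv).
(* The pointwise topology is the supremum of those induced by the evaluations. [cvg_image] asks that
   each evaluation be onto; constant functions are the preimages. *)
apply/cvg_sup => v; apply/cvg_image.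
  by rewrite eqEsubset; split=> r // _; exists (cst r).
move=> S /(cf v x Xx) FS; exists ((@^~ v) @^-1` S) => //.
rewrite eqEsubset; split=> [r [g Sg <-]//|r Sr]; by exists (cst r).
Qed.

Lemma continuous_onD X (f g : T -> R) :
  continuous_on X f -> continuous_on X g -> continuous_on X (fun x => f x + g x).
Proof. by move=> cf cg x Xx; apply: cvgD; [exact: cf|exact: cg]. Qed.

Lemma continuous_onB X (f g : T -> R) :
  continuous_on X f -> continuous_on X g -> continuous_on X (fun x => f x - g x).
Proof. by move=> cf cg x Xx; apply: cvgB; [exact: cf|exact: cg]. Qed.

Lemma continuous_onM X (f g : T -> R) :
  continuous_on X f -> continuous_on X g -> continuous_on X (fun x => f x * g x).
Proof. by move=> cf cg x Xx; apply: cvgM; [exact: cf|exact: cg]. Qed.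

Lemma continuous_on_sum (I : finType) X (f : I -> T -> R) :
  (forall i, continuous_on X (f i)) -> continuous_on X (fun x => \sum_i f i x).
Proof.
move=> cf x Xx; elim: (index_enum I) => [|i s IH].
  by under eq_fun do rewrite big_nil; rewrite big_nil; exact: cvg_cst.
under eq_fun do rewrite big_cons.
by rewrite big_cons; apply: cvgD => //; exact: cf.
Qed.

Lemma continuous_onV X (f : T -> R) :
  continuous_on X f -> (forall x, X x -> f x != 0) ->
  continuous_on X (fun x => (f x)^-1).
Proof. by move=> cf f0 x Xx; apply: cvgV; [exact: f0|exact: cf]. Qed.

(** At a zero of r the product is squeezed between 0 and the absolute value of r. Elsewhere r is
    nonzero nearby, so only the continuity of h off the zeros of r matters; h may be arbitrary on
    them. *)
Lemma continuous_on_bounded_mul X (r h : T -> R) :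
  continuous_on X r -> continuous_on (X `&` [set x | r x != 0]) h ->
  (forall x, X x -> r x != 0 -> `|h x| <= 1) ->
  continuous_on X (fun x => r x * h x).
Proof.
move=> cr ch h1 x Xx; have [r0|r0] := eqVneq (r x) 0.
  have nr : `|r y| @[y --> within X (nbhs x)] --> (0 : R).
    by rewrite -(normr0 R) -r0; apply: cvg_norm; exact: cr.
  rewrite r0 mul0r; apply/norm_cvg0P.
  apply: (@squeeze_cvgr _ _ _ _ (cst 0) (fun y => `|r y|)) => //; last exact: cvg_cst.
  rewrite /prop_near1 /within /= nbhs_simpl; apply: nearW => y Xy.
  rewrite normr_ge0 /= normrM; have [->|ry] := eqVneq (r y) 0.
    by rewrite normr0 mul0r.
  by rewrite ler_piMr // h1.
apply: cvgM; first exact: cr.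
have Fr : \forall y \near within X (nbhs x), r y != 0.
  by have /cvgr_neq0 := cr x Xx; apply.
apply: cvg_trans (ch _ (conj Xx r0)); apply: cvg_app => S.
rewrite /= /within /= => hS.
have {}Fr : nbhs x (fun y => X y -> r y != 0) := Fr.
have {}hS : nbhs x (fun y => (X `&` [set x | r x != 0]) y -> S y) := hS.
change (nbhs x (fun y => X y -> S y)).
apply: (filterS _ (filterI Fr hS)) => y [ry ryS] Xy.
by apply: ryS; split=> //; exact: ry.
Qed.
End ContinuityOn.

(** * Composition and concatenation of equivariant homotopies *)

Section Homotopy.
Variables (R : realType) (gT : finGroupType) (K : {set gT}).

Lemma equivariant_map_comp (T U W : topologicalType)
    (aT : T -> gT -> T) (X : set T) (aU : U -> gT -> U) (Y : set U)
    (aW : W -> gT -> W) (Z : set W) (f : T -> U) (g : U -> W) :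
  equivariant_map K aT X aU Y f -> equivariant_map K aU Y aW Z g ->
  equivariant_map K aT X aW Z (g \o f).
Proof.
case=> /continuous_onP cf fXY fK [/continuous_onP cg gYZ gK]; split.
- by apply/continuous_onP; exact: continuous_on_comp fXY cg.
- by move=> x Xx; apply: gYZ; exact: fXY.
- by move=> x k Xx kK /=; rewrite fK // gK //; exact: fXY.
Qed.

Lemma equivariantly_homotopic_compl (T U W : topologicalType)
    (aT : T -> gT -> T) (X : set T) (aU : U -> gT -> U) (Y : set U)
    (aW : W -> gT -> W) (Z : set W) (f g : T -> U) (h : U -> W) :
  equivariantly_homotopic R K aT X aU Y f g -> equivariant_map K aU Y aW Z h ->
  equivariantly_homotopic R K aT X aW Z (h \o f) (h \o g).
Proof.
case=> H [/continuous_onP cH HY HK H0 H1] [/continuous_onP ch hYZ hK].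
exists (h \o H); split=> /=.
- apply/continuous_onP; apply: (continuous_on_comp cH _ ch).
  by case=> x s [Xx Is]; exact: HY.
- by move=> x s Xx Is; apply: hYZ; exact: HY.
- by move=> x s k Xx Is kK; rewrite HK // hK //; exact: HY.
- by move=> x Xx; rewrite H0.
- by move=> x Xx; rewrite H1.
Qed.

Lemma equivariantly_homotopic_compr (T U W : topologicalType)
    (aT : T -> gT -> T) (X : set T) (aU : U -> gT -> U) (Y : set U)
    (aW : W -> gT -> W) (Z : set W) (h : T -> U) (f g : U -> W) :
  equivariant_map K aT X aU Y h -> equivariantly_homotopic R K aU Y aW Z f g ->
  equivariantly_homotopic R K aT X aW Z (f \o h) (g \o h).
Proof.
move=> [/continuous_onP ch hXY hK] [H [/continuous_onP cH HZ HK H0 H1]].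
exists (fun z => H (h z.1, z.2)); split=> /=.
- apply/continuous_onP.
  apply: (@continuous_on_comp (T * R)%type (U * R)%type _ _ (Y `*` `[0, 1])
    (fun z => (h z.1, z.2)) H).
  + apply: continuous_on_pair.
    * apply: (@continuous_on_comp (T * R)%type T _ _ X fst h) => //.
      - by apply: continuousW => z; exact: cvg_fst.
      - by case=> x s [].
    * by apply: continuousW => z; exact: cvg_snd.
  + by case=> x s [Xx Is]; split=> //=; exact: hXY.
  + exact: cH.
- by move=> x s Xx Is; apply: HZ => //; exact: hXY.
- by move=> x s k Xx Is kK; rewrite hK // HK //; exact: hXY.
- by move=> x Xx; rewrite H0 //; exact: hXY.
- by move=> x Xx; rewrite H1 //; exact: hXY.
Qed.

Lemma equivariantly_homotopic_ext (T U : topologicalType)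
    (aT : T -> gT -> T) (X : set T) (aU : U -> gT -> U) (Y : set U)
    (f f' g g' : T -> U) :
  {in X, f =1 f'} -> {in X, g =1 g'} ->
  equivariantly_homotopic R K aT X aU Y f g ->
  equivariantly_homotopic R K aT X aU Y f' g'.
Proof.
move=> ff' gg' [H [cH HY HK H0 H1]]; exists H; split=> // x Xx.
- by rewrite -ff' ?inE ?H0.
- by rewrite -gg' ?inE ?H1.
Qed.

Lemma equivariantly_homotopic_refl (T U : topologicalType)
    (aT : T -> gT -> T) (X : set T) (aU : U -> gT -> U) (Y : set U) f :
  equivariant_map K aT X aU Y f -> equivariantly_homotopic R K aT X aU Y f f.
Proof.
move=> [/continuous_onP cf fXY fK]; exists (f \o fst); split=> //=.
- apply/continuous_onP; apply: (@continuous_on_comp (T * R)%type T _ _ X fst f) => //.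
  + by apply: continuousW => z; exact: cvg_fst.
  + by case=> x s [].
- by move=> x s Xx _; exact: fXY.
- by move=> x s k Xx _; exact: fK.
Qed.

(** Time changes for concatenation: [lo] traverses [0, 1] during the first half and then rests at 1,
    while [hi] rests at 0 and then traverses [0, 1]. *)
Let lo (s : R) := Num.min 1 (s + s).
Let hi (s : R) := Num.max 0 (s + s - 1).

Let lo_hi s : `[0, 1]%classic s ->
  `[0, 1]%classic (lo s) /\ hi s = 0 \/ lo s = 1 /\ `[0, 1]%classic (hi s).
Proof.
rewrite /= !in_itv /= => /andP[s0 s1].
have [h|h] := leP (s + s) 1; [left|right].
  rewrite /lo /hi (min_idPr h) max_l ?h ?andbT; first by split=> //; exact: addr_ge0.
  by rewrite subr_le0.
rewrite /lo /hi (min_idPl (ltW h)) max_r ?subr_ge0 ?(ltW h)//; split=> //.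
by rewrite lerBlDr lerD.
Qed.

Let lo_continuous : continuous lo.
Proof.
by move=> s; apply: (@continuous_min R R^o (cst 1) (fun s => s + s));
  [exact: cvg_cst|apply: cvgD; exact: cvg_id].
Qed.

Let hi_continuous : continuous hi.
Proof.
move=> s; apply: (@continuous_max R R^o (cst 0) (fun s => s + s - 1)).
  exact: cvg_cst.
by apply: cvgB; [apply: cvgD; exact: cvg_id|exact: cvg_cst].
Qed.

(* Since the target is a set of real functions, the concatenation of H1 and H2 *)
(* can be written H1 + H2 - H2(_, 0) after reparametrization, and its          *)
(* continuity needs no pasting.                                                *)
Lemma equivariantly_homotopic_trans (T : topologicalType)
    (aT : T -> gT -> T) (X : set T) (G : {set gT}) (V : finType)
    (to : action G V) (Y : set {ptws V -> R}) (f g h : T -> {ptws V -> R}) :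
  equivariantly_homotopic R K aT X (@realization_act R _ _ _ to) Y f g ->
  equivariantly_homotopic R K aT X (@realization_act R _ _ _ to) Y g h ->
  equivariantly_homotopic R K aT X (@realization_act R _ _ _ to) Y f h.
Proof.
move=> [H1 [/continuous_onP cH1 H1Y H1K H10 H11]].
move=> [H2 [/continuous_onP cH2 H2Y H2K H20 H21]].
pose H (z : T * R) : {ptws V -> R} :=
  fun v => H1 (z.1, lo z.2) v + H2 (z.1, hi z.2) v - H2 (z.1, 0) v.
have I0 : `[0, 1]%classic (0 : R) by rewrite /= in_itv /= lexx ler01.
have I1 : `[0, 1]%classic (1 : R) by rewrite /= in_itv /= lexx ler01.
(* Each value of [H] is a value of [H1] or of [H2], because the two agree with g where they meet;
   this keeps the sum and difference of vectors inside Y. *)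
have HE x s : X x -> `[0, 1]%classic s ->
    H (x, s) = H1 (x, lo s) /\ `[0, 1]%classic (lo s) \/
    H (x, s) = H2 (x, hi s) /\ `[0, 1]%classic (hi s).
  move=> Xx /lo_hi[[Il hi0]|[lo1 Ih]]; [left|right]; split=> //.
    by apply/funext => v; rewrite /H /= hi0 addrK.
  by apply/funext => v; rewrite /H /= lo1 H11 // H20 // addrC addKr.
exists H; split.
- have reparam (u : R -> R) (F : T * R -> {ptws V -> R}) v :
      continuous u -> (forall s, `[0, 1]%classic s -> `[0, 1]%classic (u s)) ->
      @continuous_on (T * R)%type _ (X `*` `[0, 1]) F ->
      @continuous_on (T * R)%type _ (X `*` `[0, 1]) (fun z => F (z.1, u z.2) v).
    move=> cu uI cF; move: v; apply/continuous_on_ptws.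
    apply: (@continuous_on_comp (T * R)%type (T * R)%type _ _ (X `*` `[0, 1])
      (fun z => (z.1, u z.2)) F).
    + apply: continuous_on_pair; first by apply: continuousW => z; exact: cvg_fst.
      apply: continuousW => z; apply: continuous_comp; first exact: cvg_snd.
      exact: cu.
    + by case=> x s [Xx Is]; split=> //=; exact: uI.
    + exact: cF.
  apply/continuous_onP/continuous_on_ptws => v.
  apply: continuous_onB; first apply: continuous_onD.
  + apply: reparam => // s /lo_hi[[]//|[-> _]//].
  + apply: reparam => // s /lo_hi[[_ ->]//|[]//].
  + by apply: (reparam (cst 0)) => // ?; exact: cvg_cst.
- by move=> x s Xx Is; case: (HE x s Xx Is) => -[-> ?]; [exact: H1Y|exact: H2Y].
- move=> x s k Xx Is kK; apply/funext => v.
  have Il : `[0, 1]%classic (lo s) by case: (lo_hi Is) => [[]//|[-> _]].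
  have Ih : `[0, 1]%classic (hi s) by case: (lo_hi Is) => [[_ ->]|[]//].
  by rewrite /H /= H1K // !H2K.
- move=> x Xx; apply/funext => v; rewrite /H /= /lo /hi addr0 sub0r.
  by rewrite (min_idPr ler01) max_l ?lerN10 // addrK H10.
- move=> x Xx; apply/funext => v; rewrite /H /= /lo /hi addrK.
  by rewrite min_l ?lerDl// (max_idPr ler01) H11 // H20 // addrC addKr H21.
Qed.

Lemma equivariantly_homotopy_equivalent_trans (G1 G2 G3 : {set gT})
    (V1 V2 V3 : finType) (to1 : action G1 V1) (to2 : action G2 V2)
    (to3 : action G3 V3) (X : set {ptws V1 -> R}) (Y : set {ptws V2 -> R})
    (Z : set {ptws V3 -> R}) :
  equivariantly_homotopy_equivalent R K (@realization_act R _ _ _ to1) X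
    (@realization_act R _ _ _ to2) Y ->
  equivariantly_homotopy_equivalent R K (@realization_act R _ _ _ to2) Y
    (@realization_act R _ _ _ to3) Z ->
  equivariantly_homotopy_equivalent R K (@realization_act R _ _ _ to1) X
    (@realization_act R _ _ _ to3) Z.
Proof.
move=> [f [g [mf mg gf fg]]] [f' [g' [mf' mg' gf' fg']]].
exists (f' \o f), (g \o g'); split.
- exact: equivariant_map_comp mf mf'.
- exact: equivariant_map_comp mg' mg.
- apply: equivariantly_homotopic_trans gf.
  exact: (equivariantly_homotopic_compl (equivariantly_homotopic_compr mf gf') mg).
- apply: equivariantly_homotopic_trans fg'.
  exact: (equivariantly_homotopic_compl (equivariantly_homotopic_compr mg' fg) mf').
Qed.

Lemma equivariantly_homotopy_equivalent_sym (T U : topologicalType)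
    (aT : T -> gT -> T) (X : set T) (aU : U -> gT -> U) (Y : set U) :
  equivariantly_homotopy_equivalent R K aT X aU Y ->
  equivariantly_homotopy_equivalent R K aU Y aT X.
Proof. by move=> [f [g [mf mg gf fg]]]; exists g, f; split. Qed.

End Homotopy.

(** * Joins of realizations *)

Section JoinPoints.
Variables (R : realType) (V1 V2 : finType).
Implicit Types (t : {ptws (V1 + V2)%type -> R}).

(** The join coordinates of a point: [lmass] and [rmass] are the weights of the two factors,
    [lnormal] and [rnormal] the points that they weigh. *)
Definition lmass t : R := \sum_v t (inl v).
Definition rmass t : R := \sum_v t (inr v).
(* Junk values: [lnormal t] is 0 when [lmass t] is 0, likewise [rnormal t]. *)
Definition lnormal t : {ptws V1 -> R} := fun v => t (inl v) / lmass t.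
Definition rnormal t : {ptws V2 -> R} := fun v => t (inr v) / rmass t.

(** At an end of the join the factor of weight 0 has no point, whence the guarded conditions. *)
Definition join_points (X1 : set {ptws V1 -> R}) (X2 : set {ptws V2 -> R}) :
    set {ptws (V1 + V2)%type -> R} :=
  [set t | [/\ forall v, 0 <= t v, lmass t + rmass t = 1,
               lmass t != 0 -> X1 (lnormal t)
             & rmass t != 0 -> X2 (rnormal t)]].

(** Stated for arbitrary families of sets, so that it serves both for all simplices and for the
    fixed ones. *)
Definition join_family (S1 : {set {set V1}}) (S2 : {set {set V2}}) :
    {set {set (V1 + V2)%type}} :=
  [set s : {set (V1 + V2)%type} | [&& s != finset.set0,
     [set v | inl v \in s] \in finset.set0 |: S1
     & [set v | inr v \in s] \in finset.set0 |: S2]]%SET.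

Lemma lmass_eq0 t : (forall v, 0 <= t v) -> lmass t = 0 -> forall v, t (inl v) = 0.
Proof.
move=> t0 /eqP; rewrite psumr_eq0 // => /allP t_eq0 v.
by apply/eqP; apply: t_eq0; rewrite mem_index_enum.
Qed.

Lemma rmass_eq0 t : (forall v, 0 <= t v) -> rmass t = 0 -> forall v, t (inr v) = 0.
Proof.
move=> t0 /eqP; rewrite psumr_eq0 // => /allP t_eq0 v.
by apply/eqP; apply: t_eq0; rewrite mem_index_enum.
Qed.

Lemma lmass_ge0 t : (forall v, 0 <= t v) -> 0 <= lmass t.
Proof. by move=> t0; apply: sumr_ge0. Qed.

Lemma rmass_ge0 t : (forall v, 0 <= t v) -> 0 <= rmass t.
Proof. by move=> t0; apply: sumr_ge0. Qed.

Lemma lmass_lnormal t : (forall v, 0 <= t v) ->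
  forall v, lmass t * lnormal t v = t (inl v).
Proof.
move=> t0 v; have [l0|l0] := eqVneq (lmass t) 0.
  by rewrite l0 mul0r lmass_eq0.
by rewrite mulrC divfK.
Qed.

(** Dividing by a nonzero mass does not change supports, and a half of the support is empty exactly
    when its mass is 0. *)
Lemma realization_join (S1 : {set {set V1}}) (S2 : {set {set V2}}) :
  realization R (join_family S1 S2) =
  join_points (realization R S1) (realization R S2).
Proof.
have suppl t : lmass t != 0 ->
    [set v | lnormal t v != 0]%SET = [set v | inl v \in [set v | t v != 0]]%SET.
  move=> l0; apply/finset.setP => v; rewrite !inE mulf_eq0 invr_eq0 (negPf l0).
  by rewrite orbF.
have suppr t : rmass t != 0 ->
    [set v | rnormal t v != 0]%SET = [set v | inr v \in [set v | t v != 0]]%SET.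
  move=> r0; apply/finset.setP => v; rewrite !inE mulf_eq0 invr_eq0 (negPf r0).
  by rewrite orbF.
apply/seteqP; split=> t /=.
  move=> [t0 t1]; rewrite inE => /and3P[_ sl sr].
  split=> //; first by rewrite -t1 big_sumType.
  - move=> l0; split.
    + by move=> v; rewrite divr_ge0 ?lmass_ge0.
    + by rewrite -mulr_suml divff.
    + rewrite suppl //; move: sl; rewrite finset.in_setU1 => /orP[/eqP e|//].
      case/eqP: l0; rewrite /lmass big1 // => v _; apply/eqP.
      by have := finset.in_set0 v; rewrite -e !inE => /negPn.
  - move=> r0; split.
    + by move=> v; rewrite divr_ge0 ?rmass_ge0.
    + by rewrite -mulr_suml divff.
    + rewrite suppr //; move: sr; rewrite finset.in_setU1 => /orP[/eqP e|//].
      case/eqP: r0; rewrite /rmass big1 // => v _; apply/eqP.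
      by have := finset.in_set0 v; rewrite -e !inE => /negPn.
move=> [t0 t1 hl hr]; have t1' : \sum_v t v = 1 by rewrite -t1 big_sumType.
split=> //; rewrite inE; apply/and3P; split.
- apply/eqP => e; suff : (0 : R) = 1 by move/eqP; rewrite eq_sym oner_eq0.
  rewrite -t1' big1 // => v _; apply/eqP.
  by have := finset.in_set0 v; rewrite -e !inE => /negPn.
- rewrite finset.in_setU1; have [l0|l0] := eqVneq (lmass t) 0.
    by apply/orP; left; apply/eqP/finset.setP => v; rewrite !inE lmass_eq0 // eqxx.
  by have [_ _] := hl l0; rewrite suppl // => ->; rewrite orbT.
- rewrite finset.in_setU1; have [r0|r0] := eqVneq (rmass t) 0.
    by apply/orP; left; apply/eqP/finset.setP => v; rewrite !inE rmass_eq0 // eqxx.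
  by have [_ _] := hr r0; rewrite suppr // => ->; rewrite orbT.
Qed.

End JoinPoints.

(** * Extending maps and homotopies of the left factor to the join *)

Section JoinMap.
Variables (R : realType) (V1 W1 V2 : finType).

(** The join of f with the identity. Where [lmass t] is 0, the factor [lmass t] kills the
    meaningless value of f. *)
Definition joinmap (f : {ptws V1 -> R} -> {ptws W1 -> R})
    (t : {ptws (V1 + V2)%type -> R}) : {ptws (W1 + V2)%type -> R} :=
  fun w => match w with
           | inl w1 => lmass t * f (lnormal t) w1
           | inr v2 => t (inr v2)
           end.

(** What makes [joinmap] preserve the left mass and keeps the coordinates of f bounded by 1. *)
Definition probability_vectors (V : finType) (X : set {ptws V -> R}) :=
  forall x, X x -> (forall v, 0 <= x v) /\ \sum_v x v = 1.

Variables (X1 : set {ptws V1 -> R}) (Y1 : set {ptws W1 -> R}).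
Variable (X2 : set {ptws V2 -> R}).
Hypothesis Y1P : probability_vectors Y1.

Lemma joinmap_points (f : {ptws V1 -> R} -> {ptws W1 -> R}) t :
  (forall x, X1 x -> Y1 (f x)) -> join_points X1 X2 t ->
  [/\ join_points Y1 X2 (joinmap f t), lmass (joinmap f t) = lmass t
    & lmass t != 0 -> lnormal (joinmap f t) = f (lnormal t)].
Proof.
move=> fXY [t0 t1 hl hr].
have lE : lmass (joinmap f t) = lmass t.
  rewrite {1}/lmass /= -mulr_sumr.
  have [->|l0] := eqVneq (lmass t) 0; first by rewrite mul0r.
  by rewrite (Y1P (fXY _ (hl l0))).2 mulr1.
have nE : lmass t != 0 -> lnormal (joinmap f t) = f (lnormal t).
  by move=> l0; apply/funext => w; rewrite /lnormal lE /= mulrC mulKf.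
split=> //; split.
- case=> [w|v] //=; have [->|l0] := eqVneq (lmass t) 0; first by rewrite mul0r.
  by rewrite mulr_ge0 ?lmass_ge0 // (Y1P (fXY _ (hl l0))).1.
- by rewrite lE.
- by rewrite lE => l0; rewrite nE //; apply: fXY; exact: hl.
- exact: hr.
Qed.

(** The set [I] is [0, 1] for homotopies and [setT] for single maps. A left coordinate is the
    continuous [lmass] times a coordinate of a probability vector, which is at most 1, so
    [continuous_on_bounded_mul] applies. *)
Lemma continuous_on_joinmap (F : {ptws V1 -> R} * R -> {ptws W1 -> R}) (I : set R) :
  @continuous_on ({ptws V1 -> R} * R)%type _ (X1 `*` I) F ->
  (forall x s, X1 x -> I s -> Y1 (F (x, s))) ->
  @continuous_on ({ptws (V1 + V2)%type -> R} * R)%type _ (join_points X1 X2 `*` I)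
    (fun z => joinmap (fun x => F (x, z.2)) z.1).
Proof.
move=> cF FY; set Q := join_points X1 X2 `*` I.
have cpt v : @continuous_on ({ptws (V1 + V2)%type -> R} * R)%type _ Q (fun z => z.1 v).
  move: v; apply/continuous_on_ptws; apply: continuousW => z; exact: cvg_fst.
have cl : @continuous_on ({ptws (V1 + V2)%type -> R} * R)%type _ Q (fun z => lmass z.1).
  by apply: continuous_on_sum => v; exact: cpt.
apply/continuous_on_ptws => -[w|v] /=; last exact: cpt.
apply: (continuous_on_bounded_mul cl).
  apply: (@continuous_on_comp ({ptws (V1 + V2)%type -> R} * R)%type
    ({ptws V1 -> R} * R)%type _ _ (X1 `*` I) (fun z => (lnormal z.1, z.2))
    (fun z => F z w)).
  - apply: continuous_on_pair; last by apply: continuousW => z; exact: cvg_snd.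
    apply/continuous_on_ptws => v; apply: continuous_onM.
      by apply: continuous_onW (cpt _) => z [].
    apply: continuous_onV; last by move=> z [].
    by apply: continuous_onW cl => z [].
  - by case=> t s [[[t0 t1 hl hr] Is] /= l0]; split=> //=; exact: hl.
  - by move: w; apply/continuous_on_ptws.
case=> t s [[t0 t1 hl hr] Is] /= l0.
have [y0 y1] := Y1P (FY _ _ (hl l0) Is).
rewrite ger0_norm // -y1 (bigD1 w) //= lerDl.
by apply: sumr_ge0.
Qed.

End JoinMap.

Lemma realization_probability (R : realType) (V : finType) (S : {set {set V}}) :
  probability_vectors (realization R S).
Proof. by move=> x [x0 x1 _]. Qed.

Section JoinAct.
Variables (R : realType) (gT : finGroupType) (G : {group gT}).

Lemma lmass_act (D1 D2 : gcomplex G) (t : {ptws (vert D1 + vert D2)%type -> R}) k :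
  lmass (realization_act (join_action D1 D2) t k) = lmass t.
Proof.
rewrite /lmass /realization_act /=.
by rewrite [RHS](reindex_inj (act_inj (gact D1) k^-1%g)).
Qed.

Lemma lnormal_act (D1 D2 : gcomplex G) (t : {ptws (vert D1 + vert D2)%type -> R}) k :
  lnormal (realization_act (join_action D1 D2) t k) =
  realization_act (gact D1) (lnormal t) k.
Proof. by apply/funext => v; rewrite /lnormal lmass_act. Qed.

Variables (K : {set gT}) (D1 E1 D2 : gcomplex G).
Variables (X1 : set {ptws vert D1 -> R}) (Y1 : set {ptws vert E1 -> R}).
Variable (X2 : set {ptws vert D2 -> R}).
Hypothesis Y1P : probability_vectors Y1.

Lemma joinmap_act f t k :
  (forall x, X1 x ->
     f (realization_act (gact D1) x k) = realization_act (gact E1) (f x) k) ->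
  join_points X1 X2 t ->
  joinmap f (realization_act (join_action D1 D2) t k) =
  realization_act (join_action E1 D2) (joinmap f t) k.
Proof.
move=> fk [t0 t1 hl hr]; apply/funext => -[w|v] //=.
rewrite lmass_act lnormal_act {2}/realization_act /=.
have [->|l0] := eqVneq (lmass t) 0; first by rewrite !mul0r.
by rewrite fk //; exact: hl.
Qed.

Lemma equivariantly_homotopic_joinmap f g :
  equivariantly_homotopic R K (@realization_act R _ _ _ (gact D1)) X1
    (@realization_act R _ _ _ (gact E1)) Y1 f g ->
  equivariantly_homotopic R K
    (@realization_act R _ _ _ (join_action D1 D2)) (join_points X1 X2)
    (@realization_act R _ _ _ (join_action E1 D2)) (join_points Y1 X2)
    (joinmap f) (joinmap g).
Proof.
move=> [H [/continuous_onP cH HY HK H0 H1]].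
have ext h h' t : (forall x, X1 x -> h x = h' x) -> join_points X1 X2 t ->
    joinmap h t = joinmap h' t :> {ptws (vert E1 + vert D2)%type -> R}.
  move=> hh' [_ _ hl _]; apply/funext => -[w|v] //=.
  have [->|l0] := eqVneq (lmass t) 0; first by rewrite !mul0r.
  by rewrite hh' //; exact: hl.
exists (fun z => joinmap (fun x => H (x, z.2)) z.1); split.
- by apply/continuous_onP; apply: (continuous_on_joinmap Y1P cH).
- move=> t s Xt Is; have [] := joinmap_points Y1P (f := fun x => H (x, s)) _ Xt => //.
  by move=> x Xx; exact: HY.
- move=> t s k Xt Is kK /=; apply: joinmap_act => // x Xx; exact: HK.
- by move=> t Xt; apply: ext Xt => x Xx; exact: H0.
- by move=> t Xt; apply: ext Xt => x Xx; exact: H1.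
Qed.

Lemma equivariant_map_joinmap f :
  equivariant_map K (@realization_act R _ _ _ (gact D1)) X1
    (@realization_act R _ _ _ (gact E1)) Y1 f ->
  equivariant_map K
    (@realization_act R _ _ _ (join_action D1 D2)) (join_points X1 X2)
    (@realization_act R _ _ _ (join_action E1 D2)) (join_points Y1 X2)
    (joinmap f).
Proof.
move=> [/continuous_onP cf fXY fK]; split.
- apply/continuous_onP.
  have cF := continuous_on_joinmap (X1 := X1) (X2 := X2) Y1P
    (F := f \o fst) (I := setT).
  (* A single map is treated as a family constant in time, evaluated at time 0. *)
  apply: (@continuous_on_comp _ ({ptws (vert D1 + vert D2)%type -> R} * R)%type _ _
    (join_points X1 X2 `*` setT) (fun t => (t, 0))
    (fun z => joinmap (fun x => (f \o fst) (x, z.2)) z.1)) => //.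
    apply: (@continuous_on_pair _ _ R _ id (cst 0)).
      by apply: continuousW => t.
    by apply: continuousW; exact: cst_continuous.
  apply: cF; last by move=> x s Xx _; exact: fXY.
  apply: (@continuous_on_comp ({ptws vert D1 -> R} * R)%type _ _ _ X1 fst f) => //.
    by apply: continuousW => z; exact: cvg_fst.
  by case=> x s [].
- by move=> t Xt; have [] := joinmap_points Y1P fXY Xt.
- by move=> t k Xt kK; apply: joinmap_act => // x Xx; exact: fK.
Qed.

End JoinAct.

(** * Equivalence and contractibility of joins *)

Section JoinEquivalence.
Variables (R : realType) (gT : finGroupType) (G : {group gT}).

Lemma joinmap_id (V1 V2 : finType) (t : {ptws (V1 + V2)%type -> R}) :
  (forall v, 0 <= t v) -> joinmap id t = t.
Proof. by move=> t0; apply/funext => -[v|v] //=; rewrite lmass_lnormal. Qed.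

Lemma joinmap_comp (V1 W1 U1 V2 : finType) (Y1 : set {ptws W1 -> R})
    (X1 : set {ptws V1 -> R}) (X2 : set {ptws V2 -> R})
    (f : {ptws V1 -> R} -> {ptws W1 -> R}) (g : {ptws W1 -> R} -> {ptws U1 -> R})
    (t : {ptws (V1 + V2)%type -> R}) :
  probability_vectors Y1 -> (forall x, X1 x -> Y1 (f x)) -> join_points X1 X2 t ->
  joinmap (g \o f) t = joinmap g (joinmap f t).
Proof.
move=> YP fXY Xt; have [_ lE nE] := joinmap_points YP fXY Xt.
apply/funext => -[u|v] //=; rewrite lE.
have [->|l0] := eqVneq (lmass t) 0; first by rewrite !mul0r.
by rewrite nE.
Qed.

Lemma equivariantly_homotopy_equivalent_joinl (K : {set gT}) (D1 E1 D2 : gcomplex G)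
    (X1 : set {ptws vert D1 -> R}) (Y1 : set {ptws vert E1 -> R})
    (X2 : set {ptws vert D2 -> R}) :
  probability_vectors X1 -> probability_vectors Y1 ->
  equivariantly_homotopy_equivalent R K
    (@realization_act R _ _ _ (gact D1)) X1 (@realization_act R _ _ _ (gact E1)) Y1 ->
  equivariantly_homotopy_equivalent R K
    (@realization_act R _ _ _ (join_action D1 D2)) (join_points X1 X2)
    (@realization_act R _ _ _ (join_action E1 D2)) (join_points Y1 X2).
Proof.
move=> XP YP [f [g [mf mg gf fg]]]; exists (joinmap f), (joinmap g).
have [_ fXY _] := mf; have [_ gYX _] := mg.
split; [exact: equivariant_map_joinmap..|idtac|idtac].
- apply: equivariantly_homotopic_ext (equivariantly_homotopic_joinmap X2 XP gf).
    by move=> t /set_mem Xt; rewrite (joinmap_comp _ YP fXY Xt).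
  by move=> t /set_mem[t0 _ _ _]; rewrite joinmap_id.
- apply: equivariantly_homotopic_ext (equivariantly_homotopic_joinmap X2 YP fg).
    by move=> t /set_mem Xt; rewrite (joinmap_comp _ XP gYX Xt).
  by move=> t /set_mem[t0 _ _ _]; rewrite joinmap_id.
Qed.

(** Contracting the left factor to a fixed point [a] deforms the join into a cone with apex [a], and
    a cone contracts linearly. *)
Lemma equivariantly_contractible_joinl (K : {set gT}) (D1 D2 : gcomplex G)
    (X1 : set {ptws vert D1 -> R}) (X2 : set {ptws vert D2 -> R}) :
  probability_vectors X1 ->
  equivariantly_contractible R K (@realization_act R _ _ _ (gact D1)) X1 ->
  equivariantly_contractible R K
    (@realization_act R _ _ _ (join_action D1 D2)) (join_points X1 X2).
Proof.
move=> XP [a [Xa aK ha]]; have [a0 a1] := XP _ Xa.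
pose apex : {ptws (vert D1 + vert D2)%type -> R} :=
  fun v => match v with inl v1 => a v1 | inr _ => 0 end.
have lapex : lmass apex = 1 by [].
have rapex : rmass apex = 0 by rewrite /rmass big1.
exists apex; split.
- split.
  + by case.
  + by rewrite lapex rapex addr0.
  + by rewrite (_ : lnormal apex = a) //; apply/funext => v; rewrite /lnormal lapex divr1.
  + by rewrite rapex eqxx.
- move=> k /aK ak; apply/funext => -[v|v] //=.
  by rewrite -[in RHS]ak.
(* First contract the left factor to [a], then slide linearly to the apex. *)
have := equivariantly_homotopic_joinmap X2 XP ha.
move/(equivariantly_homotopic_ext (f' := id) (g' := joinmap (cst a)) _ _) => hJ.
apply: equivariantly_homotopic_trans.
  apply: hJ => // t /set_mem[t0 _ _ _]; exact: joinmap_id.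
(* At time s a share s of the right mass has moved to [a]. The total mass stays 1, and [rnormal]
   does not change as long as right mass remains. *)
pose H (z : {ptws (vert D1 + vert D2)%type -> R} * R) :
    {ptws (vert D1 + vert D2)%type -> R} :=
  fun v => match v with
           | inl v1 => (lmass z.1 + z.2 * rmass z.1) * a v1
           | inr v2 => (1 - z.2) * z.1 (inr v2)
           end.
exists H; split.
- apply/continuous_onP/continuous_on_ptws => w.
  have ccoord v : @continuous_on ({ptws (vert D1 + vert D2)%type -> R} * R)%type _
      (join_points X1 X2 `*` `[0, 1]) (fun z => z.1 v).
    by move: v; apply/continuous_on_ptws; apply: continuousW => z; exact: cvg_fst.
  have cpar : @continuous_on ({ptws (vert D1 + vert D2)%type -> R} * R)%type _
      (join_points X1 X2 `*` `[0, 1]) snd.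
    by apply: continuousW => z; exact: cvg_snd.
  have ccst (c : R) : @continuous_on ({ptws (vert D1 + vert D2)%type -> R} * R)%type _
      (join_points X1 X2 `*` `[0, 1]) (fun=> c).
    by apply: continuousW; exact: cst_continuous.
  case: w => v; last by apply: continuous_onM => //; exact: continuous_onB.
  apply: continuous_onM => //; apply: continuous_onD.
    by apply: continuous_on_sum => u; exact: ccoord.
  by apply: continuous_onM => //; apply: continuous_on_sum => u; exact: ccoord.
- move=> t s [t0 t1 hl hr]; rewrite /= in_itv /= => /andP[s0 s1].
  have lE : lmass (H (t, s)) = lmass t + s * rmass t.
    by rewrite {1}/lmass /= -mulr_sumr a1 mulr1.
  have rE : rmass (H (t, s)) = (1 - s) * rmass t.
    by rewrite {1}/rmass /= -mulr_sumr.
  split.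
  + case=> v /=; first by rewrite mulr_ge0 // addr_ge0 ?mulr_ge0 ?lmass_ge0 ?rmass_ge0.
    by rewrite mulr_ge0 ?subr_ge0.
  + by rewrite lE rE mulrBl mul1r -addrA addrC [s * _ + _]addrC subrK addrC.
  + rewrite lE => l0; rewrite (_ : lnormal _ = a) //; apply/funext => v.
    by rewrite /lnormal lE /= mulrC mulKf.
  + rewrite rE mulf_eq0 negb_or => /andP[s0' r0].
    rewrite (_ : rnormal _ = rnormal t); first exact: hr.
    by apply/funext => v; rewrite /rnormal rE /= -mulf_div divff // mul1r.
- move=> t s k [t0 t1 hl hr] _ kK; apply/funext => -[v|v] //=.
  rewrite lmass_act; have -> : rmass (realization_act (join_action D1 D2) t k) = rmass t.
    by rewrite /rmass [RHS](reindex_inj (act_inj (gact D2) k^-1%g)).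
  by rewrite -[in LHS](aK k kK).
- move=> t _; apply/funext => -[v|v] /=.
    by rewrite mul0r addr0.
  by rewrite subr0 mul1r.
- move=> t [t0 t1 _ _]; apply/funext => -[v|v] /=.
    by rewrite mul1r t1 mul1r.
  by rewrite subrr mul0r.
Qed.

End JoinEquivalence.

(** * Complexes and synthetic buildings *)

Section SimplicialMaps.
Variables (R : realType) (gT : finGroupType) (G : {group gT}).

(** In barycentric coordinates, precomposition with [psi] is the affine extension of the vertex
    bijection [phi]. *)
Lemma equivariant_map_pullback (D E : gcomplex G) (phi : vert D -> vert E)
    (psi : vert E -> vert D) :
  cancel phi psi -> cancel psi phi ->
  (forall v g, g \in G -> psi (gact E v g) = gact D (psi v) g) ->
  (forall s : {set vert D}, s \in simplices D -> phi @: s \in simplices E) ->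
  equivariant_map G (@realization_act R _ _ _ (gact D)) (realization R (simplices D))
    (@realization_act R _ _ _ (gact E)) (realization R (simplices E))
    (fun t => t \o psi).
Proof.
move=> phiK psiK psiG phiS; split.
- apply/continuous_onP/continuous_on_ptws => v; apply: continuousW.
  exact: (@proj_continuous _ (fun=> R) (psi v)).
- move=> t [t0 t1 tD]; split=> [v||]; first exact: t0.
  + by rewrite -t1 [RHS](reindex psi) //; apply: onW_bij; exists phi.
  + rewrite (_ : [set v | _]%SET = phi @: [set v | t v != 0]%SET); first exact: phiS.
    apply/finset.setP => v; rewrite inE /= -{2}[v]psiK (mem_imset _ _ (can_inj phiK)).
    by rewrite inE.
- by move=> t g _ gG; apply/funext => v; rewrite /realization_act /= psiG // groupV.
Qed.

(** With both maps [id] it also relates complexes that have the same simplices, without an equality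
    of records. *)
Lemma G_homotopy_equivalent_iso (D E : gcomplex G) (phi : vert D -> vert E)
    (psi : vert E -> vert D) :
  cancel phi psi -> cancel psi phi ->
  (forall v g, g \in G -> phi (gact D v g) = gact E (phi v) g) ->
  (forall s : {set vert D}, (s \in simplices D) = (phi @: s \in simplices E)) ->
  G_homotopy_equivalent R D E.
Proof.
move=> phiK psiK phiG phiS.
have m1 : equivariant_map G
    (@realization_act R _ _ _ (gact D)) (realization R (simplices D))
    (@realization_act R _ _ _ (gact E)) (realization R (simplices E))
    (fun t => t \o psi).
  apply: (equivariant_map_pullback phiK psiK) => [v g gG|s]; last by rewrite phiS.
  by apply: (can_inj phiK); rewrite phiG // !psiK.
have m2 : equivariant_map G
    (@realization_act R _ _ _ (gact E)) (realization R (simplices E))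
    (@realization_act R _ _ _ (gact D)) (realization R (simplices D))
    (fun t => t \o phi).
  apply: (equivariant_map_pullback psiK phiK) => // s; rewrite phiS -imset_comp.
  by rewrite (eq_imset _ psiK) imset_id.
exists (fun t => t \o psi), (fun t => t \o phi); split=> //.
- have h := equivariantly_homotopic_refl R (equivariant_map_comp m1 m2).
  apply: equivariantly_homotopic_ext h => //.
  by move=> t _; apply/funext => v /=; rewrite phiK.
- have h := equivariantly_homotopic_refl R (equivariant_map_comp m2 m1).
  apply: equivariantly_homotopic_ext h => //.
  by move=> t _; apply/funext => v /=; rewrite psiK.
Qed.

Lemma G_homotopy_equivalent_refl (D : gcomplex G) : G_homotopy_equivalent R D D.
Proof. by apply: (@G_homotopy_equivalent_iso D D id id) => // s; rewrite imset_id. Qed.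

Lemma G_homotopy_equivalent_sym (D E : gcomplex G) :
  G_homotopy_equivalent R D E -> G_homotopy_equivalent R E D.
Proof. exact: equivariantly_homotopy_equivalent_sym. Qed.

Lemma G_homotopy_equivalent_trans (D E F : gcomplex G) :
  G_homotopy_equivalent R D E -> G_homotopy_equivalent R E F ->
  G_homotopy_equivalent R D F.
Proof. exact: equivariantly_homotopy_equivalent_trans. Qed.

End SimplicialMaps.

(** * Restriction of equivariant maps and homotopies to [SB] *)

Section SBFunctor.
Variables (R : realType) (gT : finGroupType) (G : {group gT}) (p : nat).

(** By [simplices_stab] an element preserving the carrier fixes its vertices, hence every point
    carried by it; conversely, fixing a point preserves its support. *)
Lemma stabilizer_support (D : gcomplex G) (t : {ptws vert D -> R}) g :
  realization R (simplices D) t ->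
  (g \in stabilizer D [set v | t v != 0]%SET) <->
  g \in G /\ realization_act (gact D) t g = t.
Proof.
move=> [_ _ tD]; split=> [gS|[gG tg]].
  have gG : g \in G by move: gS; rewrite !inE => /andP[].
  split=> //; have := fintype.subsetP (simplices_stab tD) g gS.
  rewrite !inE => /andP[_ /andP[_ /fintype.subsetP fx]].
  have fixg v : t v != 0 -> gact D v g = v.
    by move=> tv; have := fx v; rewrite !inE => /(_ tv) /eqP.
  apply/funext => v; rewrite /realization_act.
  have [tv|tv] := eqVneq (t v) 0; last first.
    by rewrite -{1}(fixg v tv) actKin.
  (* If the translated coordinate were nonzero, g would fix the vertex [gact D v g^-1], which would
     then be v itself, where t vanishes. *)
  rewrite tv; apply/eqP/negPn/negP => tvg.
  have := fixg _ tvg; rewrite actKVin // => e.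
  by move: tvg; rewrite -e tv eqxx.
rewrite !inE gG /=; apply/fintype.subsetP => v; rewrite !inE.
by rewrite -{2}tg /realization_act actKin.
Qed.

Lemma realization_SB (D : gcomplex G) (t : {ptws vert D -> R}) :
  realization R (simplices (SB p D)) t <->
  realization R (simplices D) t /\
  (p %| #|stabilizer D [set v | t v != 0%R]%SET|)%N.
Proof.
rewrite /realization /= inE; split.
  by move=> [t0 t1 /andP[tD pt]].
by move=> [[t0 t1 tD] pt]; split=> //; rewrite tD.
Qed.

(** The stabilizer of t is contained in that of u, and Lagrange passes on the divisibility. Applied
    to the image u of t under an equivariant map or one stage of a homotopy. *)
Lemma realization_SB_image (D E : gcomplex G) (t : {ptws vert D -> R})
    (u : {ptws vert E -> R}) :
  realization R (simplices (SB p D)) t -> realization R (simplices E) u ->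
  (forall g, g \in G -> realization_act (gact D) t g = t ->
     realization_act (gact E) u g = u) ->
  realization R (simplices (SB p E)) u.
Proof.
move=> /realization_SB[tD pt] uE tu; apply/realization_SB; split=> //.
apply: dvdn_trans pt _; apply: cardSg; apply/fintype.subsetP => g.
move=> /(stabilizer_support g tD)[gG tg].
by apply/(stabilizer_support g uE); split=> //; exact: tu.
Qed.

Lemma realization_SB_sub (D : gcomplex G) :
  realization R (simplices (SB p D)) `<=` realization R (simplices D).
Proof. by move=> t /realization_SB[]. Qed.

Lemma equivariant_map_SB (D E : gcomplex G) f :
  equivariant_map G (@realization_act R _ _ _ (gact D)) (realization R (simplices D))
    (@realization_act R _ _ _ (gact E)) (realization R (simplices E)) f ->
  equivariant_map G (@realization_act R _ _ _ (gact (SB p D)))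
    (realization R (simplices (SB p D)))
    (@realization_act R _ _ _ (gact (SB p E))) (realization R (simplices (SB p E))) f.
Proof.
move=> [/continuous_onP cf fDE fG]; split.
- by apply/continuous_onP; apply: continuous_onW cf; exact: realization_SB_sub.
- move=> t tS; have tD := realization_SB_sub tS.
  apply: (realization_SB_image tS (fDE _ tD)) => g gG tg.
  by rewrite -fG // tg.
- by move=> t g /realization_SB_sub; exact: fG.
Qed.

Lemma equivariantly_homotopic_SB (D E : gcomplex G) f g :
  equivariantly_homotopic R G
    (@realization_act R _ _ _ (gact D)) (realization R (simplices D))
    (@realization_act R _ _ _ (gact E)) (realization R (simplices E)) f g ->
  equivariantly_homotopic R G (@realization_act R _ _ _ (gact (SB p D)))
    (realization R (simplices (SB p D)))
    (@realization_act R _ _ _ (gact (SB p E))) (realization R (simplices (SB p E))) f g.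
Proof.
move=> [H [/continuous_onP cH HE HG H0 H1]]; exists H; split.
- apply/continuous_onP; apply: continuous_onW cH => -[t s] [/= tS Is].
  by split=> //; exact: realization_SB_sub tS.
- move=> t s tS Is; have tD := realization_SB_sub tS.
  apply: (realization_SB_image tS (HE _ _ tD Is)) => k kG tk.
  by rewrite -HG // tk.
- by move=> t s k /realization_SB_sub; exact: HG.
- by move=> t /realization_SB_sub; exact: H0.
- by move=> t /realization_SB_sub; exact: H1.
Qed.

Lemma G_homotopy_equivalent_SB (D E : gcomplex G) :
  G_homotopy_equivalent R D E -> G_homotopy_equivalent R (SB p D) (SB p E).
Proof.
move=> [f [g [mf mg gf fg]]]; exists f, g; split.
- exact: equivariant_map_SB.
- exact: equivariant_map_SB.
- exact: equivariantly_homotopic_SB.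
- exact: equivariantly_homotopic_SB.
Qed.

End SBFunctor.

(** Adjoining the empty set removes the side condition of non-emptiness, so iterated joins unfold
    into independent conditions on the parts. *)
Lemma in_join_family0 (V1 V2 : finType) (S1 : {set {set V1}}) (S2 : {set {set V2}})
    (s : {set (V1 + V2)%type}) :
  (s \in finset.set0 |: join_family S1 S2)%SET =
  ([set v | inl v \in s] \in finset.set0 |: S1)%SET
  && ([set v | inr v \in s] \in finset.set0 |: S2)%SET.
Proof.
rewrite finset.in_setU1 [s \in join_family _ _]inE.
have [->|//] := eqVneq s finset.set0.
by symmetry; apply/andP; split; rewrite finset.in_setU1; apply/orP; left;
  apply/eqP/finset.setP => v; rewrite !inE.
Qed.

(** * The join up to equivariant equivalence *)

Section JoinOfComplexes.
Variables (R : realType) (gT : finGroupType) (G : {group gT}).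
Implicit Types (D E : gcomplex G).

Lemma join_simplicesE D1 D2 :
  simplices (join D1 D2) = join_family (simplices D1) (simplices D2).
Proof.
apply/finset.setP => s; rewrite [in RHS]inE.
by apply/join_simplicesP/and3P => -[].
Qed.

Lemma G_homotopy_equivalent_joinl D1 E1 D2 :
  G_homotopy_equivalent R D1 E1 ->
  G_homotopy_equivalent R (join D1 D2) (join E1 D2).
Proof.
move=> DE; rewrite /G_homotopy_equivalent !join_simplicesE !realization_join.
by apply: equivariantly_homotopy_equivalent_joinl => //; exact: realization_probability.
Qed.

Lemma G_homotopy_equivalent_joinC D1 D2 :
  G_homotopy_equivalent R (join D1 D2) (join D2 D1).
Proof.
pose swap (A B : Type) (v : A + B) : B + A :=
  match v with inl a => inr a | inr b => inl b end.
have swapK A B : cancel (@swap A B) (@swap B A) by case.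
apply: (@G_homotopy_equivalent_iso R gT G (join D1 D2) (join D2 D1)
  (@swap _ _) (@swap _ _) (swapK _ _) (swapK _ _)) => [[v|v] g _|s] //.
rewrite !join_simplicesE [LHS]inE [RHS]inE imset_eq0; congr (_ && _).
rewrite andbC; congr (_ && _); congr (in_mem _ _); apply/finset.setP => v; rewrite !inE.
  by rewrite -[inl v]/(swap _ _ (inr v)) (mem_imset _ _ (can_inj (swapK _ _))).
by rewrite -[inr v]/(swap _ _ (inl v)) (mem_imset _ _ (can_inj (swapK _ _))).
Qed.

(** The right factor is replaced by swapping the factors, acting on the left one, and swapping
    back. *)
Lemma G_homotopy_equivalent_join D1 E1 D2 E2 :
  G_homotopy_equivalent R D1 E1 -> G_homotopy_equivalent R D2 E2 ->
  G_homotopy_equivalent R (join D1 D2) (join E1 E2).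
Proof.
move=> h1 h2; apply: G_homotopy_equivalent_trans (G_homotopy_equivalent_joinl D2 h1) _.
apply: G_homotopy_equivalent_trans (G_homotopy_equivalent_joinC E1 D2) _.
apply: G_homotopy_equivalent_trans (G_homotopy_equivalent_joinl E1 h2) _.
exact: G_homotopy_equivalent_joinC.
Qed.

Lemma G_homotopy_equivalent_joinA D1 D2 D3 :
  G_homotopy_equivalent R (join D1 (join D2 D3)) (join (join D1 D2) D3).
Proof.
pose phi (v : vert D1 + (vert D2 + vert D3)) : (vert D1 + vert D2) + vert D3 :=
  match v with
  | inl a => inl (inl a) | inr (inl b) => inl (inr b) | inr (inr c) => inr c
  end.
pose psi (v : (vert D1 + vert D2) + vert D3) : vert D1 + (vert D2 + vert D3) :=
  match v with
  | inl (inl a) => inl a | inl (inr b) => inr (inl b) | inr c => inr (inr c)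
  end.
have phiK : cancel phi psi by case=> [|[]].
have psiK : cancel psi phi by case=> [[]|].
apply: (@G_homotopy_equivalent_iso R gT G (join D1 (join D2 D3)) (join (join D1 D2) D3)
  phi psi phiK psiK) => [v g _|s]; first by case: v => [|[]].
have m v : (phi v \in phi @: s) = (v \in s) by rewrite (mem_imset _ _ (can_inj phiK)).
rewrite !join_simplicesE.
rewrite [LHS]inE [RHS]inE imset_eq0 !in_join_family0.
congr (_ && _); rewrite andbA.
congr (_ && _ && _); congr (in_mem _ _); apply/finset.setP => v; rewrite !inE.
- by rewrite -[LHS]m.
- by rewrite -[LHS]m.
- by rewrite -[LHS]m.
Qed.

End JoinOfComplexes.

(** * [SB] of joins *)

Section SyntheticJoin.
Variables (R : realType) (gT : finGroupType) (G : {group gT}) (p : nat).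
Implicit Types (D E : gcomplex G).

(** An element that preserves a join simplex preserves its left part, so p already divides the order
    of the stabilizer of that part. *)
Lemma SB_joinl D1 D2 :
  SB_simplices p (join (SB p D1) D2) = SB_simplices p (join D1 D2).
Proof.
apply/finset.setP => s; rewrite [LHS]inE [RHS]inE; apply: andb_id2r => ps.
rewrite !join_simplicesE [LHS]inE [RHS]inE; congr [&& _, _ & _].
rewrite !finset.in_setU1 [_ \in simplices (SB p _)]inE; congr (_ || _).
rewrite andb_idr // => _; apply: dvdn_trans ps _; apply: cardSg.
apply/fintype.subsetP => g; rewrite !inE => /andP[-> /= /fintype.subsetP gs].
by apply/fintype.subsetP => v; rewrite !inE => /gs; rewrite inE.
Qed.

Lemma SB_joinr D1 D2 :
  SB_simplices p (join D1 (SB p D2)) = SB_simplices p (join D1 D2).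
Proof.
apply/finset.setP => s; rewrite [LHS]inE [RHS]inE; apply: andb_id2r => ps.
rewrite !join_simplicesE [LHS]inE [RHS]inE; congr [&& _, _ & _].
rewrite !finset.in_setU1 [_ \in simplices (SB p _)]inE; congr (_ || _).
rewrite andb_idr // => _; apply: dvdn_trans ps _; apply: cardSg.
apply/fintype.subsetP => g; rewrite !inE => /andP[-> /= /fintype.subsetP gs].
by apply/fintype.subsetP => v; rewrite !inE => /gs; rewrite inE.
Qed.

Lemma G_homotopy_equivalent_SB_joinA D1 D2 D3 :
  G_homotopy_equivalent R (SB p (join D1 (SB p (join D2 D3))))
    (SB p (join (SB p (join D1 D2)) D3)).
Proof.
have h1 : G_homotopy_equivalent R (SB p (join D1 (SB p (join D2 D3))))
    (SB p (join D1 (join D2 D3))).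
  apply: (@G_homotopy_equivalent_iso R gT G (SB p (join D1 (SB p (join D2 D3))))
    (SB p (join D1 (join D2 D3))) id id) => // s.
  by rewrite imset_id /= SB_joinr.
have h2 : G_homotopy_equivalent R (SB p (join (join D1 D2) D3))
    (SB p (join (SB p (join D1 D2)) D3)).
  apply: (@G_homotopy_equivalent_iso R gT G (SB p (join (join D1 D2) D3))
    (SB p (join (SB p (join D1 D2)) D3)) id id) => // s.
  by rewrite imset_id /= SB_joinl.
apply: (G_homotopy_equivalent_trans h1); apply: G_homotopy_equivalent_trans h2.
by apply: G_homotopy_equivalent_SB; exact: G_homotopy_equivalent_joinA.
Qed.

(** A join simplex is fixed by P exactly when both its parts are. Its stabilizer then contains P,
    whose order p divides, so [SB] discards none of these simplices. *)
Lemma fixed_simplices_SB_join D1 D2 (P : {group gT}) :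
  P \subset G -> (p.-group P)%g -> P :!=: 1%g ->
  fixed_simplices (SB p (join D1 D2)) P =
  join_family (fixed_simplices D1 P) (fixed_simplices D2 P).
Proof.
move=> PG pP P1; have [_ pdvd _] := pgroup_pdiv pP P1.
have fixE (s : {set (vert D1 + vert D2)%type}) :
    (s \subset 'Fix_(join_action D1 D2)(P)%g) =
    (join_lpart s \subset 'Fix_(gact D1)(P)%g) &&
    (join_rpart s \subset 'Fix_(gact D2)(P)%g).
  apply/fintype.subsetP/andP => [fs|[/fintype.subsetP fl /fintype.subsetP fr] [v|v] vs].
  - split; apply/fintype.subsetP => v; rewrite inE => /fs /afixP fv;
      apply/afixP => g gP;
      by case: (fv g gP).
  - have /afixP fv : v \in 'Fix_(gact D1)(P)%g by apply: fl; rewrite inE.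
    by apply/afixP => g gP /=; rewrite fv.
  - have /afixP fv : v \in 'Fix_(gact D2)(P)%g by apply: fr; rewrite inE.
    by apply/afixP => g gP /=; rewrite fv.
have fixS D (s : {set vert D}) :
    (s \in finset.set0 |: fixed_simplices D P)%SET =
    (s \in finset.set0 |: simplices D)%SET && (s \subset 'Fix_(gact D)(P)%g).
  rewrite !finset.in_setU1 [s \in fixed_simplices _ _]inE.
  by have [->|//] := eqVneq s finset.set0; rewrite finset.sub0set.
apply/finset.setP => s; rewrite [RHS]inE !fixS [LHS]inE [s \in simplices _]inE.
rewrite join_simplicesE [s \in join_family _ _]inE fixE.
rewrite -!/(join_lpart s) -!/(join_rpart s).
have [fs|] := boolP (join_lpart s \subset 'Fix_(gact D1)(P)%g); last by rewrite !andbF.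
have [gs|] := boolP (join_rpart s \subset 'Fix_(gact D2)(P)%g); last by rewrite !andbF.
rewrite !andbT andb_idr // => _; apply: dvdn_trans pdvd _; apply: cardSg.
have /fintype.subsetP fixs : s \subset 'Fix_(join_action D1 D2)(P)%g.
  by rewrite fixE fs gs.
apply/fintype.subsetP => g gP; rewrite !inE (fintype.subsetP PG) //=.
apply/fintype.subsetP => v vs; have /afixP/(_ g gP) /= e := fixs v vs.
by rewrite inE /= e.
Qed.

Lemma synthetic_building_SB_join D1 D2 :
  synthetic_building R p D1 -> synthetic_building R p (SB p (join D1 D2)).
Proof.
move=> [w1 _]; split=> [P PG pP P1|s]; last by rewrite inE => /andP[].
rewrite fixed_simplices_SB_join // realization_join.
apply: equivariantly_contractible_joinl; first exact: realization_probability.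
exact: w1.
Qed.

(** * The operation on equivalence classes *)

Lemma synthetic_classes_nonempty (C : synthetic_classes R G p) : exists D, sval C D.
Proof.
case: C => C /= [D sD ->]; exists D; split=> //; exact: G_homotopy_equivalent_refl.
Qed.

Lemma synthetic_classes_building (C : synthetic_classes R G p) D :
  sval C D -> synthetic_building R p D.
Proof. by case: C => C /= [E sE ->] []. Qed.

Lemma synthetic_classes_equivalent (C : synthetic_classes R G p) D E :
  sval C D -> sval C E -> G_homotopy_equivalent R D E.
Proof.
case: C => C /= [F sF ->] [_ h1] [_ h2].
exact: G_homotopy_equivalent_trans (G_homotopy_equivalent_sym h1) h2.
Qed.

Lemma synthetic_classes_closed (C : synthetic_classes R G p) D E :
  sval C D -> G_homotopy_equivalent R D E -> synthetic_building R p E -> sval C E.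
Proof.
case: C => C /= [F sF ->] [_ h1] h2 sE; split=> //.
exact: G_homotopy_equivalent_trans h1 h2.
Qed.

(** A common member forces the same members by transitivity; extensionality and proof irrelevance
    turn this into equality. *)
Lemma synthetic_classes_eq (C C' : synthetic_classes R G p) D :
  sval C D -> sval C' D -> C = C'.
Proof.
suff sub (B B' : synthetic_classes R G p) E :
    sval B D -> sval B' D -> sval B E -> sval B' E.
  move=> CD C'D; apply: eq_sig_hprop; first by move=> ?; exact: Prop_irrelevance.
  by apply/funext => E; apply/propext; split; [exact: sub CD C'D|exact: sub C'D CD].
move=> BD B'D BE; apply: synthetic_classes_closed B'D _ _.
  exact: synthetic_classes_equivalent BD BE.
exact: synthetic_classes_building BE.
Qed.

(** Ranging over all representatives avoids choosing any. *)
Definition join_class (C1 C2 : synthetic_classes R G p) (E : gcomplex G) : Prop :=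
  exists D1 D2, [/\ sval C1 D1, sval C2 D2 & synthetic_class R p (SB p (join D1 D2)) E].

(** This is the well-definedness: any two pairs of representatives give equivalent products, so
    their classes coincide. *)
Lemma join_classP (C1 C2 : synthetic_classes R G p) :
  exists2 D, synthetic_building R p D & join_class C1 C2 = synthetic_class R p D.
Proof.
have [D1 C1D1] := synthetic_classes_nonempty C1.
have [D2 C2D2] := synthetic_classes_nonempty C2.
exists (SB p (join D1 D2)).
  exact: synthetic_building_SB_join (synthetic_classes_building C1D1).
apply/funext => E; apply/propext; split=> [|EC]; last by exists D1, D2.
move=> [E1 [E2 [C1E1 C2E2 [sE h]]]]; split=> //; apply: G_homotopy_equivalent_trans h.
apply: G_homotopy_equivalent_SB; apply: G_homotopy_equivalent_join.
  exact: synthetic_classes_equivalent C1D1 C1E1.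
exact: synthetic_classes_equivalent C2D2 C2E2.
Qed.

End SyntheticJoin.

Theorem proposition7p10 (R : realType) (gT : finGroupType) (G : {group gT})
    (p : nat) (p_prime : prime p) :
  exists op : synthetic_classes R G p -> synthetic_classes R G p ->
              synthetic_classes R G p,
    unique (fun op' : synthetic_classes R G p -> synthetic_classes R G p ->
                          synthetic_classes R G p =>
              forall (C1 C2 : synthetic_classes R G p)
                     (D1 D2 : gcomplex G),
              sval C1 D1 -> sval C2 D2 ->
              sval (op' C1 C2) (SB p (join D1 D2))) op
    /\ associative op.
Proof.
pose op (C1 C2 : synthetic_classes R G p) : synthetic_classes R G p :=
  exist _ _ (join_classP C1 C2).
have opE C1 C2 D1 D2 : sval C1 D1 -> sval C2 D2 -> sval (op C1 C2) (SB p (join D1 D2)).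
  move=> C1D1 C2D2; exists D1, D2; split=> //; split.
    exact: synthetic_building_SB_join (synthetic_classes_building C1D1).
  exact: G_homotopy_equivalent_refl.
exists op; split.
  split=> // op' op'E; apply/funext => C1; apply/funext => C2.
  have [D1 C1D1] := synthetic_classes_nonempty C1.
  have [D2 C2D2] := synthetic_classes_nonempty C2.
  (* Both operations put the same building [SB p (join D1 D2)] in their value. *)
  exact: synthetic_classes_eq (opE _ _ _ _ C1D1 C2D2) (op'E _ _ _ _ C1D1 C2D2).
move=> C1 C2 C3.
have [D1 C1D1] := synthetic_classes_nonempty C1.
have [D2 C2D2] := synthetic_classes_nonempty C2.
have [D3 C3D3] := synthetic_classes_nonempty C3.
have h := opE _ _ _ _ C1D1 (opE _ _ _ _ C2D2 C3D3).
have h' := opE _ _ _ _ (opE _ _ _ _ C1D1 C2D2) C3D3.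
(* It is enough that the class of one bracketing contains the representative of the other. *)
apply: (synthetic_classes_eq _ h'); apply: synthetic_classes_closed h _ _.
  exact: G_homotopy_equivalent_SB_joinA.
exact: synthetic_classes_building h'.
Qed.
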